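(* Let $\ell \ge -1$, $r \ge 3$, and \[n \ge \begin{cases} 6\ell+26 & \text{if } r=3\\ \max\{3+ \ell + \frac{4(\ell+2)}{r-3},\,5+\ell+\frac{r+2\ell+7}{2r-2}\} & \text{if } 4 \le r \le 7\\ \ell+5+\frac{4(\ell+4)}{r-4} & \text{if } r \ge 8\end{cases}\] be integers, or let $(\ell,r,n)=(1,8,10)$. Let $G$ be an $n$-vertex, $K_{r+1}$-free graph with degrees $d_1 \le \cdots \le d_n$. If there is an integer $j$ with $1 \le j \le (n-1-\ell)/2$ such that $d_j \le j+\ell$, then, for all $t \ge 2$, $k^t(G) \le k^t(G^{\ell *}_{n,r})$. Equality holds if $G \cong G^{\ell *}_{n,r}$.
   Context: Graphs are simple. $e(G)$ is the number of edges of $G$, and $k^t(G)$ is the number of $t$-cliques of $G$ (sets of $t$ pairwise adjacent vertices). $T_r(n)$ is the Turán graph: the $n$-vertex complete $r$-partite graph with parts as balanced as possible (so $T_r(n)=K_n$ if $n\le r$). For $-1 \le \ell \le \lfloor (r-1)n/r\rfloor - 1$, $G^{\ell *}_{n,r}$ is the $n$-vertex $r$-partite colex Turán graph with $m = e(T_r(n-1))+\ell+1$ edges: its vertex set is $\{1,\dots,n\}$ and its edges are the first $m$ pairs $\{i,j\}$ of positive integers with $i\not\equiv j \pmod r$ in colexicographic order ($A<_C B$ iff $\max(A\triangle B)\in B$). Equivalently, $\{1,\dots,n-1\}$ with classes mod $r$ forms $T_r(n-1)$ and vertex $n$ is adjacent to exactly the $\ell+1$ smallest $i<n$ with $i\not\equiv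 n \pmod r$ (vertex $n$ is isolated if $\ell=-1$). *)

(* Defs.v *)
From mathcomp Require Import all_boot all_order all_algebra.

Set Implicit Arguments.
Unset Strict Implicit.
Unset Printing Implicit Defensive.

Import Order.TTheory GRing.Theory Num.Theory.

Record sgraph := SGraph {
  vertex :> finType;
  adj : rel vertex;
  adj_sym : symmetric adj;
  adj_irrefl : irreflexive adj }.

Definition iso (G H : sgraph) : Prop :=
  exists f : G -> H, bijective f /\ {mono f : x y / adj x y}.

Definition edges (G : sgraph) : {set {set G}} :=
  [set A | [exists x, exists y, adj x y && (A == [set x; y])]].

Definition num_edges (G : sgraph) : nat := #|edges G|.

Definition is_clique (G : sgraph) (A : {set G}) : bool :=
  [forall x in A, forall y in A, (x != y) ==> adj x y].

Definition num_cliques (t : nat) (G : sgraph) : nat :=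
  #|[set A : {set G} | is_clique A & #|A| == t]|.

Definition clique_free (s : nat) (G : sgraph) : Prop :=
  forall A : {set G}, is_clique A -> #|A| <> s.

Definition degree (G : sgraph) (x : G) : nat := #|[set y | adj x y]|.

(* d_1 <= ... <= d_n, numbered from 1 *)
Definition sorted_degree (G : sgraph) (j : nat) : nat :=
  nth 0 (sort leq [seq degree x | x : G]) j.-1.

(* The i-th vertex is the ordinal of value i - 1.  Incongruence modulo r and
   the colexicographic order are invariant under this shift. *)

Definition turan_adj (r n : nat) (i j : 'I_n) : bool := i != j %[mod r].

Lemma turan_sym r n : symmetric (@turan_adj r n).
Proof. by move=> i j; rewrite /turan_adj eq_sym. Qed.

Lemma turan_irrefl r n : irreflexive (@turan_adj r n).
Proof. by move=> i; rewrite /turan_adj eqxx. Qed.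

(* The parts are the residue classes modulo r, which are balanced. *)
Definition turan (r n : nat) : sgraph :=
  SGraph (@turan_sym r n) (@turan_irrefl r n).

(* A <_C B iff the maximum of the symmetric difference lies in B *)
Definition colex (n : nat) (A B : {set 'I_n}) : bool :=
  [exists x in B :\: A, forall y in (A :\: B) :|: (B :\: A), y <= x].

(* An r-partite pair contained in {1, ..., n} is among the first m of all
   r-partite pairs of positive integers iff fewer than m such pairs precede it;
   these are again contained in {1, ..., n}, so that it suffices to count in
   edges (turan r n).  Here m = e(T_r(n-1)) + l + 1. *)
Definition colex_turan_edge (l : int) (r n : nat) (A : {set 'I_n}) : bool :=
  (A \in edges (turan r n)) &&
  (#|[set B in edges (turan r n) | colex B A]|%:Z
     < (num_edges (turan r n.-1))%:Z + l + 1)%R.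

Definition colex_turan_adj (l : int) (r n : nat) (i j : 'I_n) : bool :=
  (i != j) && colex_turan_edge l r [set i; j].

Lemma colex_turan_sym l r n : symmetric (@colex_turan_adj l r n).
Proof. by move=> i j; rewrite /colex_turan_adj eq_sym setUC. Qed.

Lemma colex_turan_irrefl l r n : irreflexive (@colex_turan_adj l r n).
Proof. by move=> i; rewrite /colex_turan_adj eqxx. Qed.

Definition colex_turan (l : int) (r n : nat) : sgraph :=
  SGraph (@colex_turan_sym l r n) (@colex_turan_irrefl l r n).

Local Open Scope ring_scope.

Definition order_bound (l : int) (r : nat) : rat :=
  let lq := l%:~R in
  let rq := r%:R in
  if (r == 3)%N then 6 * lq + 26
  else if (r <= 7)%N then
    Num.max (3 + lq + 4 * (lq + 2) / (rq - 3))
            (5 + lq + (rq + 2 * lq + 7) / (2 * rq - 2))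
  else lq + 5 + 4 * (lq + 4) / (rq - 4).

(* Main.v *)
Require Import Defs.
From mathcomp Require Import all_boot all_order all_algebra.
From mathcomp Require Import zify lra.

Set Implicit Arguments.
Unset Strict Implicit.
Unset Printing Implicit Defensive.

Import Order.TTheory GRing.Theory Num.Theory.

(** Write [L = l + 1] and [j = p + 1], so that [p + 1] vertices have degree at
most [p + L], and let [K x] be the number of [(t - 1)]-cliques of the Turan
graph [T_(r-1)(x)].

Upper bound.  By Zykov's theorem ([ncliques_le_turan]) a [K_(r+1)]-free graph on
[m] vertices has at most as many [t]-cliques as [T_r(m)], and a vertex of
degree [d], whose neighbourhood is [K_r]-free, lies in at most [K d] of them.
Deleting any [q + 1 <= j] of the low-degree vertices therefore gives
[k^t(G) <= k^t(T_r(n-q-1)) + (q + 1) K(p + L)] ([num_cliques_le]).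

Lower bound.  The colex Turan graph consists of [T_r(n-1)] and one vertex joined
to a copy of [T_(r-1)(L)], so that it has at least [k^t(T_r(n-1)) + K L] cliques
([colex_turan_num_cliques_ge]).  Building [T_r(n-1)] from [T_r(n-q-1)] vertex by
vertex turns this into
[k^t(T_r(n-q-1)) + K L + (K b_1 + ... + K b_q)], where
[b_k = s - floor(s/r)] with [s = n - k - 1] is the degree of the vertex added to
[T_r(s)].

Comparison.  It remains to see that
[(q + 1) K(p + L) <= K L + K b_1 + ... + K b_q].  The function [K] is convex and
nondecreasing ([turan_cliques_tangent]), so by Jensen's inequality
([tangent_jensen]) it is enough to have this inequality for the identity in
place of [K], which is a statement about numbers of edges:
[q (p + L) + p <= b_1 + ... + b_q].

Arithmetic.  The lower bound on [n] has to provide some [q <= p] with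
[q (p + L) + p <= b_1 + ... + b_q] ([admissible_degree_sum]).  The choice
[q = p], that is, deleting all [j] vertices, works for [r >= 8].  For [r = 3] it
fails when [j] is close to [n / 2], because [n^2/4] plus the number of edges of
[T_3(n/2)] is already asymptotic to the number of edges of [T_3(n)]; deleting a
bounded number of vertices succeeds there. *)

(** * Clique numbers of Turan graphs *)

(** [turan_degree r s] is the degree of a new vertex put into a smallest part,
of size [s %/ r], of [T_r(s)]; it is also the number of vertices of [T_r(s)]
outside such a part. *)
Local Notation turan_degree r s := (s - s %/ r)%N.

(** The number of [t]-cliques of [T_r(n)], computed by removing a smallest part:
what is left is [T_(r-1)], and a clique has at most one vertex in the part.  All
statements about Turan graphs are derived from this recursion, which makes
sense without vertex labels. *)
Fixpoint turan_cliques r n t : nat :=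
  if r is r'.+1 then
    turan_cliques r' (turan_degree r n) t
    + n %/ r * (if t is t'.+1 then turan_cliques r' (turan_degree r n) t' else 0)
  else t == 0.

Lemma turan_cliques0 r n : turan_cliques r n 0 = 1.
Proof. by elim: r n => //= r IH n; rewrite IH muln0. Qed.

Lemma turan_cliquesS r n t :
  turan_cliques r.+1 n t.+1 =
  turan_cliques r (turan_degree r.+1 n) t.+1
  + n %/ r.+1 * turan_cliques r (turan_degree r.+1 n) t.
Proof. by []. Qed.

Lemma turan_cliques1 r n : turan_cliques r.+1 n 1 = n.
Proof.
elim: r n => [|r IH] n; rewrite turan_cliquesS turan_cliques0 muln1.
  by rewrite /= divn1.
by rewrite IH subnK ?leq_div.
Qed.

Arguments turan_cliques : simpl never.

(** Adding a vertex to a smallest part of [T_r(n)] gives [T_r(n+1)], and its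
neighbourhood is [T_(r-1)].  In the recursion on [r], the new vertex lands in the
removed part exactly when [r] divides [n + 1]. *)
Lemma turan_cliques_incr r n t :
  turan_cliques r.+1 n.+1 t.+1 =
  turan_cliques r.+1 n t.+1 + turan_cliques r (turan_degree r.+1 n) t.
Proof.
elim: r n t => [|r IH] n t.
  rewrite !turan_cliquesS !divn1 !subnn mulSn; lia.
rewrite !(turan_cliquesS r.+1).
have le_div := leq_div n r.+2.
have [dvd_r|ndvd_r] := boolP (r.+2 %| n.+1).
  have -> : n.+1 %/ r.+2 = (n %/ r.+2).+1 by rewrite divnS // dvd_r.
  by rewrite subSS mulSn; lia.
have Eq : n.+1 %/ r.+2 = n %/ r.+2 by rewrite divnS // (negbTE ndvd_r).
rewrite Eq subSn // IH.
set d := n - n %/ r.+2.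
have Ed : d %/ r.+1 = n %/ r.+2.
  have Emod : n %% r.+2 < r.+1.
    have := ltn_pmod n (isT : 0 < r.+2).
    rewrite ltnS leq_eqVlt => /orP[/eqP E|//]; case/negP: ndvd_r.
    by rewrite /dvdn -addn1 -modnDml E addn1 modnn.
  rewrite /d {1}(divn_eq n r.+2).
  have -> : n %/ r.+2 * r.+2 + n %% r.+2 - n %/ r.+2
          = n %/ r.+2 * r.+1 + n %% r.+2.
    by rewrite [_ * r.+2]mulnS -addnA addKn.
  by rewrite divnMDl // (divn_small Emod) addn0.
case: t => [|t].
  by rewrite !turan_cliques0; lia.
by rewrite IH mulnDr [X in _ = _ + X]turan_cliquesS Ed; lia.
Qed.

Lemma turan_cliques_mono r m n t :
  m <= n -> turan_cliques r.+1 m t <= turan_cliques r.+1 n t.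
Proof.
move=> le_mn; rewrite -(subnKC le_mn); elim: (n - m) => [|k IH].
  by rewrite addn0.
case: t IH => [|t] IH; first by rewrite !turan_cliques0.
by rewrite addnS turan_cliques_incr (leq_trans IH) ?leq_addr.
Qed.

Lemma turan_degree_mono r : {homo (fun n => turan_degree r.+1 n) : m n / m <= n}.
Proof.
move=> m n /subnKC <-; elim: (n - m) => [|k IH]; first by rewrite addn0.
rewrite (leq_trans IH) // addnS divnS //.
by have := leq_div (m + k) r.+1; case: (_ %| _); lia.
Qed.

(** Convexity of the number of cliques in the number of vertices: its increments
are clique numbers of [T_(r-1)] at the degrees of the added vertices, and both
are nondecreasing.  The inequality says that the graph lies above its tangent at
[x], with all terms on the side where they are positive. *)
Lemma turan_cliques_tangent r t x y :
  turan_cliques r.+2 x t.+1 + turan_cliques r.+1 (turan_degree r.+2 x) t * y <=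
  turan_cliques r.+2 y t.+1 + turan_cliques r.+1 (turan_degree r.+2 x) t * x.
Proof.
set D := turan_cliques r.+1 (x - _) t; pose K n := turan_cliques r.+2 n t.+1.
rewrite -/(K x) -/(K y).
have KS n : K n.+1 = K n + turan_cliques r.+1 (turan_degree r.+2 n) t.
  exact: turan_cliques_incr.
have [le_xy|/ltnW le_yx] := leqP x y.
  rewrite -(subnKC le_xy); elim: (y - x) => [|k IH]; first by rewrite addn0.
  rewrite addnS KS mulnS.
  have : D <= turan_cliques r.+1 (turan_degree r.+2 (x + k)) t.
    by apply/turan_cliques_mono/turan_degree_mono/leq_addr.
  lia.
suff : forall k, k <= x -> K x + D * (x - k) <= K (x - k) + D * x.
  by move/(_ _ (leq_subr y x)); rewrite subKn.
elim=> [|k IH] lt_kx; first by rewrite subn0.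
have E : x - k = (x - k.+1).+1 by lia.
move: (IH (ltnW lt_kx)); rewrite E KS mulnS.
have : turan_cliques r.+1 (turan_degree r.+2 (x - k.+1)) t <= D.
  by apply/turan_cliques_mono/turan_degree_mono/leq_subr.
lia.
Qed.

(** Jensen's inequality for the [q + 1] points [L, b_0, ..., b_(q-1)].  Since the
slope [D] is nonnegative, the mean of the points may also exceed [a]. *)
Lemma tangent_jensen (K : nat -> nat) D q a L (b : nat -> nat) :
  (forall y, K a + D * y <= K y + D * a) ->
  q.+1 * a <= L + \sum_(k < q) b k ->
  q.+1 * K a <= K L + \sum_(k < q) K (b k).
Proof.
move=> tan le_a.
have : \sum_(k < q) (K a + D * b k) <= \sum_(k < q) (K (b k) + D * a).
  by apply: leq_sum => k _.
rewrite !big_split -big_distrr !sum_nat_const card_ord /=.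
have := leq_mul (leqnn D) le_a; have := tan L.
move: (\sum_(k < q) b k) (\sum_(k < q) K (b k)) => s1 s2.
by rewrite !mulSn !mulnDr; lia.
Qed.

Lemma turan_cliques_drop r n q t : q <= n ->
  turan_cliques r.+1 n t.+1 =
  turan_cliques r.+1 (n - q) t.+1
  + \sum_(k < q) turan_cliques r (turan_degree r.+1 (n - k.+1)) t.
Proof.
elim: q => [|q IH] lt_qn; first by rewrite subn0 big_ord0 addn0.
rewrite (IH (ltnW lt_qn)) big_ord_recr /=.
have -> : n - q = (n - q.+1).+1 by lia.
by rewrite turan_cliques_incr; lia.
Qed.

(** Joining [T_r(d)] to [n - d] independent vertices gives at most as many
cliques as [T_(r+1)(n)].  As a function of [d] the left-hand side increases as
long as [d + d %/ r < n] and decreases afterwards; it is maximal for the [d] that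
leaves out a smallest part of [T_(r+1)(n)], where equality holds. *)
Lemma turan_cliques_join r n d t : d <= n ->
  turan_cliques r d t.+1 + (n - d) * turan_cliques r d t
  <= turan_cliques r.+1 n t.+1.
Proof.
case: r => [|r] le_dn.
  by rewrite /turan_cliques divn1 /=; case: (t == 0); lia.
case: t => [|t].
  by rewrite !turan_cliques1 turan_cliques0; lia.
pose g d := turan_cliques r.+1 d t.+2 + (n - d) * turan_cliques r.+1 d t.+1.
pose h d := turan_cliques r (turan_degree r.+1 d) t.
have gS e : e < n -> g e.+1 + (e + e %/ r.+1).+1 * h e = g e + n * h e.
  move=> lt_en; rewrite /g /h !turan_cliques_incr.
  have := turan_cliquesS r e t; move: (turan_cliques r.+1 e t.+1) => z.
  move: (turan_cliques r _ t.+1) (turan_cliques r _ t) => Y X Ez.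
  have [k ->] : exists k, n = e.+1 + k by exists (n - e.+1); lia.
  have -> : e.+1 + k - e.+1 = k by lia.
  have -> : e.+1 + k - e = k.+1 by lia.
  by rewrite !mulSn !mulnDl !mulnDr; lia.
have up e : e < n -> e + e %/ r.+1 < n -> g e <= g e.+1.
  by move=> lt_en lt; have := gS e lt_en; have := leq_mul lt (leqnn (h e)); lia.
have down e : e < n -> n <= (e + e %/ r.+1).+1 -> g e.+1 <= g e.
  by move=> lt_en lt; have := gS e lt_en; have := leq_mul lt (leqnn (h e)); lia.
set q := n %/ r.+2.
have le_qn : q <= n by apply: leq_div.
have En : n = q * r.+2 + n %% r.+2 by apply: divn_eq.
have lt_mod : n %% r.+2 < r.+2 by apply: ltn_pmod.
have -> : turan_cliques r.+2 n t.+2 = g (n - q).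
  by rewrite turan_cliquesS /g subKn.
rewrite -/(g d).
have [le_d|lt_d] := leqP d (n - q).
  rewrite -(subnKC le_d).
  have : d + (n - q - d) <= n - q by lia.
  elim: (n - q - d) => [|k IH]; first by rewrite addn0.
  rewrite addnS => lt_k; apply: leq_trans (IH (ltnW lt_k)) _.
  apply: up; first by lia.
  have : (d + k) %/ r.+1 < q.+1 by rewrite ltn_divLR //; lia.
  lia.
rewrite -(subnKC (ltnW lt_d)).
have : n - q + (d - (n - q)) <= n by lia.
elim: (d - (n - q)) => [|k IH]; first by rewrite addn0.
rewrite addnS => lt_k; apply: leq_trans (IH (ltnW lt_k)).
apply: down; first by lia.
have : q <= (n - q + k) %/ r.+1 by rewrite leq_divRL //; lia.
lia.
Qed.

(** * The arithmetic of the bound on n *)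

(** Dropping the rounding in [turan_degree r s >= (r - 1) s / r]. *)
Lemma sum_turan_degree_ge r n q : 0 < r -> q.+1 < n ->
  q * (r.-1 * (n.*2 - q - 3)) <=
  r.*2 * \sum_(k < q) turan_degree r (n - k.+2).
Proof.
move=> r_gt0; elim: q => [|q IH] lt_qn; first by rewrite mul0n.
rewrite big_ord_recr /=.
have ge_deg : r.-1 * (n - q.+2) <= r * turan_degree r (n - q.+2).
  have := leq_divM (n - q.+2) r.
  move: (n - q.+2) (_ %/ _) => m w.
  by case: r r_gt0 {IH} => // r _; nia.
move: (IH (ltnW lt_qn)); set s := \sum_(_ < _) _.
move: ge_deg; set x := turan_degree _ _; move: s x => s x.
have [m ->] : exists m, n = m + q.+3 by exists (n - q.+3); lia.
have -> : m + q.+3 - q.+2 = m.+1 by lia.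
have -> : (m + q.+3).*2 - q - 3 = m.*2 + q + 3 by lia.
have -> : (m + q.+3).*2 - q.+1 - 3 = m.*2 + q + 2 by lia.
by move: r.-1 => a; nia.
Qed.

(** The lower bound on the order in terms of [L = l + 1], free of denominators.
The last alternative covers all [r >= 8], the exceptional triple
[(l, r, n) = (1, 8, 10)] included. *)
Definition admissible r L n : bool :=
  [|| (r == 3) && (6 * L + 20 <= n),
      (r == 4) && (5 * L + 6 <= n),
      (r == 5) && (3 * L + 4 <= n) && (5 * L + 21 <= 4 * n),
      (r == 6) && (7 * L + 10 <= 3 * n) && (12 * L + 51 <= 10 * n),
      (r == 7) && (2 * L + 3 <= n) && (14 * L + 60 <= 12 * n) |
      (3 < r) && (L * r.+1 + 4 * r.-1 <= n * (r - 3))].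

(** A form of [turan_degree r (n - 2) + ... + turan_degree r (n - q - 1)] that
can be evaluated. *)
Definition degree_sum r n q :=
  sumn [seq turan_degree r (n - k.+2) | k <- iota 0 q].

Lemma degree_sumE r n q :
  \sum_(k < q) turan_degree r (n - k.+2) = degree_sum r n q.
Proof.
rewrite /degree_sum sumnE big_map.
by rewrite -(big_mkord xpredT (fun k => turan_degree r (n - k.+2))) /index_iota subn0.
Qed.

Definition has_prefix r L n p :=
  has (fun q => q * (p + L) + p <= degree_sum r n q) (iota 0 p.+1).

(** For small [L] and [n] the rounding in [turan_degree] cannot be neglected;
these finitely many cases are evaluated. *)
Lemma has_prefix_small :
  all (fun r => all (fun L => all (fun n => admissible r L n ==>
    all (fun p => (2 * p.+1 + L <= n) ==> has_prefix r L n p)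
    (iota 0 n)) (iota 0 28)) (iota 0 12)) (iota 3 5).
Proof. by vm_compute. Qed.

(** For fixed [q] the estimate of [sum_turan_degree_ge] reduces the claim to an
inequality that is linear in [p], [L] and [n].  The value [q = p] satisfies it
as soon as [L (r + 1) + 4 (r - 1) <= n (r - 3)].  For [r <= 7] a constant [q],
cut off at [p], satisfies it outside a finite range. *)
Lemma admissible_degree_sum r L n p : admissible r L n -> 2 * p.+1 + L <= n ->
  exists2 q, q <= p & q * (p + L) + p <= \sum_(k < q) turan_degree r (n - k.+2).
Proof.
move=> adm le_n; set goal := ex2 _ _.
have r_gt2 : 2 < r by move: adm; rewrite /admissible; lia.
have linear q : q <= p ->
    r.*2 * (q * (p + L) + p) <= q * (r.-1 * (n.*2 - q - 3)) -> goal.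
  move=> le_qp le_lin; exists q => //.
  rewrite -(@leq_pmul2l r.*2); last by lia.
  by apply: leq_trans le_lin (sum_turan_degree_ge _ _); lia.
have constant c :
    (p < c -> r.*2 * (p + L + 1) <= r.-1 * (n.*2 - p - 3)) ->
    (c <= p -> r.*2 * (c * (p + L) + p) <= c * (r.-1 * (n.*2 - c - 3))) -> goal.
  move=> lt ge; have [le_cp|lt_pc] := leqP c p; first exact: linear (ge _).
  by apply: (linear p) => //; have := leq_mul (leqnn p) (lt lt_pc); lia.
have small : r < 8 -> L < 12 -> n < 28 -> goal.
  move=> r_lt8 lt_L lt_n; have /allP/(_ r) := has_prefix_small.
  rewrite mem_iota r_gt2 => /(_ r_lt8)/allP/(_ L); rewrite mem_iota => /(_ lt_L).
  move=> /allP/(_ n); rewrite mem_iota => /(_ lt_n)/implyP/(_ adm).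
  move=> /allP/(_ p); rewrite mem_iota => /(_ ltac:(lia))/implyP/(_ le_n).
  by case/hasP=> q; rewrite mem_iota -degree_sumE; exists q => //; lia.
have [[r_lt8 [lt_L lt_n]]|large] :
    (r < 8 /\ L < 12 /\ n < 28) \/ ~~ [&& r < 8, L < 12 & n < 28] by lia.
  exact: small.
have [large_n|] := boolP (L * r.+1 + 4 * r.-1 <= n * (r - 3)).
  apply: (linear p) => //; have [k Ek] : exists k, r = k.+3 by exists (r - 3); lia.
  subst r; rewrite /= in large_n *.
  suff : k.+3.*2 * (p + L + 1) <= k.+2 * (n.*2 - p - 3).
    by move/(leq_mul (leqnn p)); lia.
  by move: large_n; rewrite !subSS subn0; nia.
move: adm; rewrite /admissible => adm; rewrite -ltnNge => small_n.
(* The constants 6 and 4 are large enough for the inequality at the largest [p],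
   namely [2 (p + 1) = n - L], and small enough for [q = p] to work below them. *)
have [r3|r_neq3] := eqVneq r 3; first by apply: (constant 6); subst r => /=; lia.
have : [|| r == 4, r == 5, r == 6 | r == 7] by lia.
by case/or4P=> /eqP Er; apply: (constant 4); subst r => /=; lia.
Qed.

(** * Counting cliques inside a set of vertices *)

Definition nbhd (G : sgraph) (v : G) : {set G} := [set y | adj v y].

(** Cliques are counted inside vertex sets of a fixed graph, rather than in
induced subgraphs, so that deleting a vertex and passing to its neighbourhood
stay within the same type. *)
Definition cliques_in (G : sgraph) t (S : {set G}) : {set {set G}} :=
  [set A : {set G} | [&& A \subset S, is_clique A & #|A| == t]].

Definition ncliques (G : sgraph) t (S : {set G}) : nat := #|cliques_in t S|.

Lemma is_cliqueP (G : sgraph) (A : {set G}) :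
  reflect {in A &, forall x y, x != y -> adj x y} (is_clique A).
Proof.
apply: (iffP 'forall_in_forall_inP) => cl x xA y.
  by move=> yA; apply/implyP/cl.
by move=> yA; apply/implyP/cl.
Qed.

Lemma is_cliqueU1 (G : sgraph) (v : G) (A : {set G}) : v \notin A ->
  is_clique (v |: A) = is_clique A && (A \subset nbhd v).
Proof.
move=> vA; apply/is_cliqueP/andP => [cl|[/is_cliqueP cl /subsetP sub] x y].
  split.
    by apply/is_cliqueP=> x y xA yA; apply: cl; rewrite inE ?xA ?yA orbT.
  apply/subsetP=> y yA; rewrite inE; apply: cl.
  - by rewrite setU11.
  - by rewrite inE yA orbT.
  by apply: contraNneq vA => ->.
move=> /setU1P[->|xA] /setU1P[->|yA]; first by rewrite eqxx.
- by move=> _; have := sub _ yA; rewrite inE.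
- by move=> _; have := sub _ xA; rewrite inE adj_sym.
exact: cl.
Qed.

Lemma ncliquesU1 (G : sgraph) t (v : G) (S : {set G}) : v \notin S ->
  ncliques t.+1 (v |: S) = ncliques t.+1 S + ncliques t (S :&: nbhd v).
Proof.
move=> vS.
have vC s A : A \in cliques_in s (S :&: nbhd v) -> v \notin A.
  rewrite inE subsetI => /andP[/andP[/subsetP sub _] _].
  by apply: contra vS => /sub.
have E : cliques_in t.+1 (v |: S) = cliques_in t.+1 S :|:
    [set v |: A | A in cliques_in t (S :&: nbhd v)].
  apply/setP=> A; rewrite in_setU; apply/idP/orP.
    rewrite inE => /and3P[subA clA cardA].
    have [vA|vA] := boolP (v \in A); [right|left].
      apply/imsetP; exists (A :\ v); last by rewrite setD1K.
      have := is_cliqueU1 (negbT (setD11 v A)); rewrite setD1K // clA => /esym.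
      move=> /andP[cl sub]; rewrite inE subsetI sub cl subDset subA /=.
      by move: cardA; rewrite (cardsD1 v A) vA.
    rewrite inE clA cardA !andbT; apply/subsetP=> x xA.
    move/subsetP/(_ x xA): subA => /setU1P[E|//].
    by rewrite -E xA in vA.
  case=> [|/imsetP[B BC ->]].
    rewrite !inE => /and3P[sub -> ->]; rewrite !andbT.
    exact: subset_trans sub (subsetUr _ _).
  have vB := vC _ _ BC; move: BC.
  rewrite !inE subsetI => /and3P[/andP[subS subN] clB cardB].
  by rewrite is_cliqueU1 // clB subN cardsU1 vB /= eqSS cardB setUS.
have E0 : cliques_in t.+1 S
    :&: [set v |: A | A in cliques_in t (S :&: nbhd v)] = set0.
  apply/setP=> A; rewrite in_set0; apply/negP; rewrite in_setI.
  move=> /andP[+ /imsetP[B _ EA]]; rewrite inE EA => /andP[/subsetP/(_ v)].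
  by rewrite setU11 (negbTE vS) => /(_ isT).
rewrite /ncliques E cardsU E0 cards0 subn0.
congr (_ + _); apply: card_in_imset => A B AC BC eqAB.
by rewrite -(setU1K (vC _ _ AC)) eqAB (setU1K (vC _ _ BC)).
Qed.

Lemma ncliques_sub (G : sgraph) t (S T : {set G}) :
  S \subset T -> ncliques t S <= ncliques t T.
Proof.
move=> subST; apply/subset_leq_card/subsetP=> A; rewrite !inE.
by case/and3P=> subA -> ->; rewrite (subset_trans subA subST).
Qed.

Lemma ncliques0 (G : sgraph) (S : {set G}) : ncliques 0 S = 1.
Proof.
apply/eqP/cards1P; exists set0; apply/setP=> A; rewrite !inE cards_eq0.
apply/and3P/eqP => [[_ _ /eqP]//|->]; rewrite sub0set eqxx; split=> //.
by apply/is_cliqueP=> x y; rewrite inE.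
Qed.

Lemma ncliques_set0 (G : sgraph) t :
  ncliques t (set0 : {set G}) = (t == 0).
Proof.
case: t => [|t]; first exact: ncliques0.
apply/eqP; rewrite cards_eq0; apply/eqP/setP=> A; rewrite !inE subset0.
by apply/negbTE/negP=> /and3P[/eqP-> _]; rewrite cards0.
Qed.

Lemma ncliques_nbhd (G : sgraph) t (v : G) (S : {set G}) :
  v \in S -> ncliques t (S :&: nbhd v) <= ncliques t.+1 S.
Proof.
move=> vS; rewrite -{2}(setD1K vS) ncliquesU1 ?setD11 //.
apply: leq_trans (leq_addl _ _); apply/ncliques_sub/subsetP=> x; rewrite !inE.
by case/andP=> -> ad; rewrite ad !andbT; apply: contraTneq ad => ->; rewrite adj_irrefl.
Qed.

(** Splitting the cliques that meet [J] by one of their vertices in [J]. *)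
Lemma ncliquesU_le (G : sgraph) c t (S J : {set G}) :
  {in J, forall u, ncliques t ((S :|: J) :&: nbhd u) <= c} ->
  ncliques t.+1 (S :|: J) <= ncliques t.+1 S + #|J| * c.
Proof.
have [n] := ubnP #|J|; elim: n J => // n IH J; rewrite ltnS => le_n le_c.
have [->|[u uJ]] := set_0Vmem J; first by rewrite setU0 leq_addr.
have le_kc : ncliques t.+1 (S :|: (J :\ u)) <= ncliques t.+1 S + #|J :\ u| * c.
  apply: IH; first by rewrite (cardsD1 u) uJ in le_n.
  move=> v /setD1P[_ vJ]; apply: leq_trans (le_c v vJ).
  by apply/ncliques_sub/setSI/setUS/subsetDl.
have EJ : S :|: J = u |: (S :|: J :\ u) by rewrite setUCA setD1K.
have [uS|uS] := boolP (u \in S :|: J :\ u).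
  have <- : S :|: J :\ u = S :|: J.
    by rewrite EJ; apply/esym/setUidPr; rewrite sub1set.
  by apply: leq_trans le_kc _; rewrite leq_add2l leq_mul2r subset_leq_card ?subsetDl ?orbT.
rewrite {1}EJ ncliquesU1 // (cardsD1 u J) uJ mulnDl mul1n.
have : ncliques t ((S :|: J :\ u) :&: nbhd u) <= c.
  by apply: leq_trans (le_c u uJ); apply/ncliques_sub/setSI/setUS/subsetDl.
lia.
Qed.

Lemma ncliquesU_ge (G : sgraph) t (S J : {set G}) :
  [disjoint S & J] -> {in J, forall u, S \subset nbhd u} ->
  ncliques t.+1 S + #|J| * ncliques t S <= ncliques t.+1 (S :|: J).
Proof.
have [n] := ubnP #|J|; elim: n J => // n IH J; rewrite ltnS => le_n dis sub.
have [->|[u uJ]] := set_0Vmem J; first by rewrite setU0 cards0 mul0n addn0.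
have : ncliques t.+1 S + #|J :\ u| * ncliques t S <= ncliques t.+1 (S :|: (J :\ u)).
  apply: IH; first by rewrite (cardsD1 u) uJ in le_n.
    exact: disjointWr (subsetDl _ _) dis.
  by move=> v /setD1P[_ /sub].
have uS : u \notin S by rewrite (disjointFl dis).
have -> : S :|: J = u |: (S :|: J :\ u) by rewrite setUCA setD1K.
rewrite (cardsD1 u J) uJ mulnDl mul1n ncliquesU1; last first.
  by rewrite !inE eqxx (negbTE uS).
have : ncliques t S <= ncliques t ((S :|: J :\ u) :&: nbhd u).
  by apply: ncliques_sub; rewrite subsetI subsetUl sub.
lia.
Qed.

(** Zykov's theorem, by induction on [r].  Let [N] be the neighbourhood of a
vertex [v] in [S] that lies in the largest number of cliques.  Every clique not
inside [N] contains one of the [#|S| - #|N|] other vertices, and each of these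
lies in at most as many cliques as [v].  Thus [S] has no more cliques than the
join of [N], which has no [r]-clique if [S] has no [r + 1]-clique, with an
independent set; that number is bounded by [turan_cliques_join]. *)
Lemma ncliques_le_turan (G : sgraph) r (S : {set G}) t :
  ncliques r.+1 S = 0 -> ncliques t S <= turan_cliques r #|S| t.
Proof.
elim: r S t => [|r IH] S t free.
  have [->|[v vS]] := set_0Vmem S; first by rewrite ncliques_set0.
  by have := ncliques_nbhd 0 vS; rewrite free ncliques0.
case: t => [|t]; first by rewrite ncliques0 turan_cliques0.
have [->|[v0 v0S]] := set_0Vmem S; first by rewrite ncliques_set0.
pose f v := ncliques t (S :&: nbhd v).
pose v := [arg max_(v > v0 in S) f v].
have [vS maxv] : v \in S /\ {in S, forall u, f u <= f v}.
  by rewrite /v; case: arg_maxnP.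
set N := S :&: nbhd v.
have freeN : ncliques r.+1 N = 0 by apply/eqP; rewrite -leqn0 -free ncliques_nbhd.
have ES : S = N :|: (S :\: N) by rewrite -[LHS](setID S N) (setIidPr _) ?subsetIl.
have le_N : #|N| <= #|S| by rewrite subset_leq_card ?subsetIl.
have := @ncliquesU_le G (f v) t N (S :\: N); rewrite -ES => /(_ _)/leq_trans; apply.
  by move=> u /setDP[uS _]; apply: maxv.
apply: leq_trans (turan_cliques_join r t le_N).
rewrite cardsD (setIidPr _) ?subsetIl // leq_add ?leq_mul2l ?IH ?orbT //.
Qed.

(** The recursion defining [turan_cliques] is matched by removing a smallest
colour class: if the class sizes differ by at most one, it has exactly
[#|S| %/ k] elements when there are [k] colours. *)
Lemma ncliques_multipartite (G : sgraph) (C : finType) (c : G -> C)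
    (cs : {set C}) (S : {set G}) t :
  {in S, forall x, c x \in cs} ->
  {in S &, forall x y, c x != c y -> adj x y} ->
  {in cs &, forall a b, #|S :&: c @^-1: [set a]| <= #|S :&: c @^-1: [set b]|.+1} ->
  turan_cliques #|cs| #|S| t <= ncliques t S.
Proof.
have [k Ek] : exists k, k = #|cs| by exists #|cs|.
rewrite -Ek; elim: k cs S t Ek => [|k IH] cs S t Ek.
  move/esym/cards0_eq: Ek => -> colS _ _.
  have -> : S = set0.
    by apply/setP=> x; rewrite in_set0; apply/negP=> /colS; rewrite inE.
  by rewrite ncliques_set0.
case: t => [|t]; first by rewrite ncliques0 turan_cliques0.
move=> colS adjS bal.
have [|[a0 a0cs]] := set_0Vmem cs; first by move=> E; rewrite E cards0 in Ek.
pose cl a := S :&: c @^-1: [set a].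
pose a := [arg min_(a < a0 in cs) #|cl a|].
have [acs mina] : a \in cs /\ {in cs, forall b, #|cl a| <= #|cl b|}.
  by rewrite /a; case: arg_minnP.
have cardS : #|S| = \sum_(b in cs) #|cl b|.
  rewrite -sum1_card (partition_big c (mem cs)) //=; apply: eq_bigr => b _.
  by rewrite -sum1_card; apply: eq_bigl => x; rewrite !inE.
have Ediv : #|S| %/ k.+1 = #|cl a|.
  have lo : #|cl a| * k.+1 <= #|S|.
    rewrite cardS Ek mulnC -sum_nat_const; apply: leq_sum => b; exact: mina.
  have hi : #|S| < #|cl a|.+1 * k.+1.
    rewrite cardS Ek mulnC -sum_nat_const (bigD1 a acs) [X in _ < X](bigD1 a acs) /=.
    rewrite addSn ltnS leq_add2l; apply: leq_sum => b /andP[bcs _]; exact: bal.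
  by apply/eqP; rewrite eqn_leq leq_divRL // -ltnS ltn_divLR // lo hi.
rewrite turan_cliquesS Ediv.
have clS : cl a \subset S by apply: subsetIl.
have -> : #|S| - #|cl a| = #|S :\: cl a| by rewrite cardsD (setIidPr clS).
have IH' s : turan_cliques k #|S :\: cl a| s <= ncliques s (S :\: cl a).
  apply: (IH (cs :\ a)).
  - by move: Ek; rewrite (cardsD1 a) acs => -[].
  - by move=> x; rewrite !inE => /andP[+ xS]; rewrite xS colS // andbT.
  - by move=> x y /setDP[xS _] /setDP[yS _]; apply: adjS.
  move=> b b' /setD1P[ba bcs] /setD1P[b'a b'cs].
  have E d : d != a -> (S :\: cl a) :&: c @^-1: [set d] = cl d.
    move=> da; apply/setP=> x; rewrite !inE.
    by case: (c x =P d) => [->|_]; rewrite ?andbF // (negbTE da) andbF.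
  by rewrite !E //; apply: bal.
have ES : (S :\: cl a) :|: cl a = S.
  by apply/setP=> x; rewrite !inE; case: (x \in S) => //=; case: (_ == _).
rewrite -[X in _ <= ncliques _ X]ES; apply: leq_trans (ncliquesU_ge _ _ _).
- by rewrite leq_add ?leq_mul2l ?IH' ?orbT.
- rewrite disjoint_sym -setI_eq0; apply/eqP/setP=> x; rewrite !inE.
  by case: (x \in S); case: (c x == a).
move=> u; rewrite !inE => /andP[uS /eqP cu]; apply/subsetP=> x.
rewrite !inE => /andP[+ xS]; rewrite xS /= => cx; apply: adjS => //.
by rewrite cu eq_sym.
Qed.


(** * Cliques of the colex Turan graph *)

Lemma card_ord_count n m (P : pred nat) : m <= n ->
  #|[set i : 'I_n | (i < m) && P i]| = count P (iota 0 m).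
Proof.
move=> le_mn; rewrite -sum1_card -sum1_count.
rewrite -[m in iota 0 m]subn0 big_mkord (big_ord_widen_cond n P (fun=> 1)) //.
by apply: eq_bigl => i; rewrite inE andbC.
Qed.

(** With [r - 1 - a] further numbers put in front, every number of residue [a]
completes a block of length [r]. *)
Lemma count_residue r m a : a < r ->
  count (fun i => i %% r == a) (iota 0 m) = (m + (r - a.+1)) %/ r.
Proof.
move=> lt_ar; have r_gt0 : 0 < r by lia.
elim: m => [|m IH]; first by rewrite divn_small //; lia.
rewrite -addn1 iotaD count_cat IH /= add0n addn0 addn1 addSn divnS // addnC.
congr (nat_of_bool _ + _).
have <- : m + (r - a) = (m + (r - a.+1)).+1 by lia.
rewrite /dvdn -modnDml; have := ltn_pmod m r_gt0; move: (m %% r) => b lt_br.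
have [->|neq] := eqVneq b a; first by rewrite subnKC ?modnn // ltnW.
have [lt_ba|le_ab] := ltnP b a.
  by rewrite modn_small; [apply/esym/negbTE; rewrite -lt0n|]; lia.
have -> : b + (r - a) = b - a + r by lia.
by rewrite modnDr modn_small; [apply/esym/negbTE; rewrite -lt0n|]; lia.
Qed.

Lemma count_residue_balanced r m a b : a < r -> b < r ->
  count (fun i => i %% r == a) (iota 0 m) <=
  (count (fun i => i %% r == b) (iota 0 m)).+1.
Proof.
move=> lt_ar lt_br; rewrite !count_residue //.
have r_gt0 : 0 < r by lia.
have <- : (m + (r - b.+1) + r) %/ r = ((m + (r - b.+1)) %/ r).+1.
  by rewrite divnDr // divnn r_gt0 addn1.
by apply: leq_div2r; lia.
Qed.

(** The edges of [T_r(n+1)] that avoid the last vertex come from [T_r(n)]. *)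
Lemma card_edges_below r n :
  #|[set B in edges (turan r n.+1) | ord_max \notin B]|
  <= num_edges (turan r n).
Proof.
pose w := widen_ord (leqnSn n).
apply: leq_trans (leq_imset_card (fun B : {set 'I_n} => w @: B) _).
apply/subset_leq_card/subsetP=> B; rewrite inE => /andP[].
rewrite inE => /existsP[x /existsP[y /andP[adj_xy /eqP ->]]].
rewrite !inE negb_or -!val_eqE /= => /andP[nx ny].
have lt_x : x < n by have := ltn_ord x; lia.
have lt_y : y < n by have := ltn_ord y; lia.
apply/imsetP; exists [set Ordinal lt_x; Ordinal lt_y].
  rewrite inE; apply/existsP; exists (Ordinal lt_x).
  by apply/existsP; exists (Ordinal lt_y); rewrite eqxx andbT.
rewrite imsetU !imset_set1.
by congr [set _; _]; apply: val_inj.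
Qed.

Lemma turan_edge r n (i j : 'I_n) :
  i != j %[mod r] -> [set i; j] \in edges (turan r n).
Proof.
move=> ij; rewrite inE; apply/existsP; exists i; apply/existsP; exists j.
by rewrite eqxx andbT.
Qed.

(** The number [l] of the colex Turan graph enters as [L - 1] with [L] a natural
number.  A pair below the last vertex is preceded in colexicographic order by
such pairs only, and it does not precede itself, so that even [L = 0] leaves
room for it. *)
Lemma colex_turan_adj_low L r n (i j : 'I_n.+1) :
  i < n -> j < n -> i != j %[mod r] ->
  @adj (colex_turan (L%:Z - 1) r n.+1) i j.
Proof.
move=> lt_in lt_jn ij; have neq_ij : i != j by apply: contraNneq ij => ->.
rewrite /= /colex_turan_adj neq_ij /colex_turan_edge turan_edge //=.
rewrite -addrA subrK -PoszD ltz_nat.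
set E := [set B in _ | _].
apply: leq_trans (leq_addr L _).
apply: leq_trans (card_edges_below r n); apply/proper_card/properP; split.
  apply/subsetP=> B; rewrite !inE => /andP[-> /existsP[x /andP[]]] /=.
  rewrite !inE => /andP[xB xij] /forallP/(_ ord_max); rewrite !inE.
  apply/contraL => maxB; rewrite maxB /= -!val_eqE /= !gtn_eqF //= -ltnNge.
  case/orP: xij => /eqP->; lia.
exists [set i; j].
  by rewrite inE turan_edge //= !inE -!val_eqE /= !gtn_eqF.
rewrite inE negb_and; apply/orP; right; apply/negP => /existsP[x].
by rewrite setDv inE.
Qed.

(** A pair of [i] and the last vertex is preceded by the pairs below the last
vertex and by the pairs of some [k < i] and the last vertex. *)
Lemma colex_turan_adj_top L r n (i : 'I_n.+1) :
  i < n -> i != n %[mod r] ->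
  #|[set k : 'I_n.+1 | (k < i) && (k != n %[mod r])]| < L ->
  @adj (colex_turan (L%:Z - 1) r n.+1) ord_max i.
Proof.
move=> lt_in ni ltL; rewrite adj_sym.
have neq : i != ord_max by rewrite -val_eqE /= neq_ltn lt_in.
rewrite /= /colex_turan_adj neq /colex_turan_edge turan_edge //=.
rewrite -addrA subrK -PoszD ltz_nat.
set E := [set B in _ | _].
set K := [set k : 'I_n.+1 | _] in ltL.
set E0 := [set B in edges (turan r n.+1) | ord_max \notin B].
have sub : E \subset E0 :|: [set [set k; ord_max] | k in K].
  apply/subsetP=> B; rewrite !inE => /andP[edB colB]; rewrite edB /=.
  have [maxB|//] := boolP (ord_max \in B); rewrite /=.
  case/existsP: edB => x /existsP[y /andP[adj_xy /eqP EB]].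
  have {x y adj_xy EB} [k kn EB] : exists2 k : 'I_n.+1,
      k != n %[mod r] & B = [set k; ord_max].
    move: maxB; rewrite EB !inE => /orP[]/eqP E1.
      by exists y; [move: adj_xy; rewrite -E1 /= /turan_adj eq_sym | rewrite -E1 setUC].
    by exists x; [move: adj_xy; rewrite -E1 | rewrite -E1].
  apply/imsetP; exists k => //; rewrite inE kn andbT.
  case/existsP: colB => x; rewrite EB !inE => /andP[].
  rewrite negb_or => /andP[/andP[xk xmax]]; rewrite (negbTE xmax) orbF => /eqP Ex.
  rewrite Ex in xk * => /forallP/(_ k); rewrite !inE eqxx /= eq_sym (negbTE xk).
  rewrite /= orbF.
  have kmax : k != ord_max by apply: contraNneq kn => ->.
  by rewrite kmax /= ltn_neqAle => ->; rewrite andbT val_eqE eq_sym.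
apply: leq_ltn_trans (subset_leq_card sub) _.
apply: leq_ltn_trans (leq_card_setU _ _) _.
by rewrite -addnS leq_add ?card_edges_below ?(leq_ltn_trans (leq_imset_card _ _)).
Qed.

(** The last vertex is joined to the [L] smallest vertices outside its residue
class, which exist by the hypothesis on [L].  They are the vertices outside this
class in an initial segment, so that the remaining [r] classes are balanced on
them, as all [r + 1] classes are on the vertices below the last one. *)
Lemma colex_turan_num_cliques_ge L r n t : 0 < r -> L + n %/ r.+1 <= n ->
  turan_cliques r.+1 n t.+1 + turan_cliques r L t
  <= num_cliques t.+1 (colex_turan (L%:Z - 1) r.+1 n.+1).
Proof.
move=> r_gt0 le_L; set G := colex_turan _ _ _.
pose c (i : G) : 'I_r.+1 := inord (val i %% r.+1).
have cE i : val (c i) = val i %% r.+1 by rewrite /= inordK // ltn_pmod.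
pose N m := count (fun i => i != n %[mod r.+1]) (iota 0 m).
have NE m : m <= n.+1 -> #|[set i : 'I_n.+1 | (i < m) && (i != n %[mod r.+1])]| = N m.
  by apply: card_ord_count.
have le_N : L <= N n.
  have := count_predC (fun i => i %% r.+1 == n %% r.+1) (iota 0 n).
  rewrite size_iota count_residue ?ltn_pmod // -[count (predC _) _]/(N n).
  suff -> : (n + (r.+1 - (n %% r.+1).+1)) %/ r.+1 = n %/ r.+1 by lia.
  rewrite {1}(divn_eq n r.+1) -addnA divnMDl // [X in _ + X]divn_small ?addn0 //.
  by have := ltn_pmod n (ltn0Sn r); lia.
(* [N m] grows by at most one at each step, so the least [m] with [L <= N m]
   has [N m = L]. *)
have exN : exists m, L <= N m by exists n.
have [m leLm minm] := ex_minnP exN.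
have le_mn : m <= n by apply: minm.
have NmL : N m = L.
  apply/eqP; rewrite eqn_leq leLm andbT.
  case: (m) minm => [|m'] minm; first by [].
  have : N m' < L by rewrite ltnNge; apply/negP => /minm; rewrite ltnn.
  rewrite /N -[m'.+1]addn1 iotaD count_cat /= addn0; case: (_ != _); lia.
pose S1 : {set G} := [set i : 'I_n.+1 | i < n].
pose S2 : {set G} := [set i : 'I_n.+1 | (i < m) && (i != n %[mod r.+1])].
have top : ord_max \notin S1 by rewrite inE ltnn.
have classE m' a : m' <= n.+1 ->
    #|[set i : G | (val i < m') && (c i == a)]| = count (fun i => i %% r.+1 == a) (iota 0 m').
  move=> le; rewrite -(@card_ord_count n.+1) //.
  by apply: eq_card => i; rewrite !inE -val_eqE cE.
have bal m' a b : m' <= n.+1 -> #|[set i : G | (val i < m') && (c i == a)]|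
    <= #|[set i : G | (val i < m') && (c i == b)]|.+1.
  by move=> le; rewrite !classE //; apply: count_residue_balanced.
have low : {in S1 &, forall x y : G, c x != c y -> adj x y}.
  move=> x y; rewrite !inE => xn yn; rewrite -val_eqE !cE.
  exact: colex_turan_adj_low.
have cl1 s : turan_cliques r.+1 n s <= ncliques s S1.
  have := @ncliques_multipartite G 'I_r.+1 c setT S1 s.
  rewrite cardsT card_ord.
  have -> : #|S1| = n.
    have := @card_ord_count n.+1 n predT (leqnSn n).
    rewrite count_predT size_iota => /esym cardn; rewrite [RHS]cardn.
    by apply: eq_card => i; rewrite !inE andbT.
  apply=> // a b _ _.
  have E d : S1 :&: c @^-1: [set d] = [set i : G | (val i < n) && (c i == d)].
    by apply/setP=> i; rewrite !inE.
  by rewrite !E; apply: bal.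
have sub21 : S2 \subset S1.
  by apply/subsetP=> i; rewrite !inE => /andP[lt _]; apply: leq_trans lt le_mn.
have cl2 s : turan_cliques r L s <= ncliques s S2.
  pose a0 : 'I_r.+1 := c ord_max.
  have := @ncliques_multipartite G 'I_r.+1 c [set~ a0] S2 s.
  rewrite cardsC1 card_ord /= NE ?(leqW le_mn) // NmL.
  apply.
  - by move=> i; rewrite !inE -val_eqE !cE => /andP[].
  - by move=> x y /(subsetP sub21) x1 /(subsetP sub21); apply: low.
  move=> a b; rewrite !inE => na nb.
  have E d : d != a0 -> S2 :&: c @^-1: [set d] = [set i : G | (val i < m) && (c i == d)].
    move=> da; apply/setP=> i; rewrite !inE.
    case: (c i =P d) => [ci|]; rewrite ?andbF //= !andbT.
    by move: da; rewrite -ci -val_eqE !cE /= => ->; rewrite andbT.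
  by rewrite !E //; apply: bal (leqW le_mn).
have sub2 : S2 \subset nbhd (ord_max : G).
  apply/subsetP=> i iS2; have := subsetP sub21 _ iS2; rewrite !inE => lt_in.
  move: iS2; rewrite inE => /andP[lt_im ni].
  apply: colex_turan_adj_top => //.
  rewrite NE ?(leqW (ltnW lt_in)) // ltnNge; apply/negP => /minm.
  by rewrite leqNgt lt_im.
apply: (@leq_trans (ncliques t.+1 ((ord_max : G) |: S1))).
  rewrite ncliquesU1 // leq_add // (leq_trans (cl2 t)) // ncliques_sub //.
  by rewrite subsetI sub21.
apply/subset_leq_card/subsetP=> A; rewrite !inE.
by case/and3P=> _ -> ->.
Qed.

(** * Comparison *)

Lemma sorted_nth_count (s : seq nat) j a : 0 < j <= size s ->
  nth 0 (sort leq s) j.-1 <= a -> j <= count (fun d => d <= a) s.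
Proof.
case: j => // j /= lt_js le_a.
have srt : sorted leq (sort leq s) by apply: sort_sorted leq_total _.
rewrite -(count_sort leq); set s' := sort leq s in le_a srt *.
have sz : size s' = size s by apply: size_sort.
rewrite -(cat_take_drop j.+1 s') count_cat (leq_trans _ (leq_addr _ _)) //.
rewrite (_ : count _ _ = j.+1) //.
have szt : size (take j.+1 s') = j.+1 by rewrite size_takel ?sz.
rewrite -[RHS]szt; apply/eqP; rewrite -all_count; apply/(all_nthP 0) => i.
rewrite szt => lt_i; rewrite nth_take //; apply: leq_trans le_a.
apply: (sorted_leq_nth leq_trans leqnn) => //; rewrite ?inE sz //.
exact: leq_trans lt_i lt_js.
Qed.

Lemma subset_of_card (T : finType) (A : {set T}) k : k <= #|A| ->
  exists2 B : {set T}, B \subset A & #|B| = k.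
Proof.
move=> le_k; exists [set x in take k (enum A)].
  by apply/subsetP=> x; rewrite inE => /mem_take; rewrite mem_enum.
by rewrite cardsE (card_uniqP _) ?take_uniq ?enum_uniq // size_takel -?cardE.
Qed.

(** The hypothesis on the [j]-th degree provides sets of [k] low-degree vertices
for every [k <= j]; the freedom to take [k < j] is essential for [r = 3]. *)
Lemma low_degree_set (G : sgraph) j a k : 0 < j <= #|G| -> k <= j ->
  sorted_degree G j <= a ->
  exists2 J : {set G}, #|J| = k & {in J, forall x, degree x <= a}.
Proof.
move=> j_in le_kj le_a.
have : k <= #|[set x : G | degree x <= a]|.
  apply: leq_trans le_kj _.
  have := @sorted_nth_count [seq degree x | x : G] j a.
  rewrite size_map -cardE => /(_ j_in le_a); rewrite count_map.
  move/leq_trans; apply; rewrite cardsE cardE -size_filter /enum_mem -filter_predI.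
  by apply/eq_leq/congr1/eq_filter => x; rewrite /= andbT.
case/subset_of_card=> J /subsetP sub cardJ; exists J => // x /sub.
by rewrite inE.
Qed.

Lemma ncliques_setT (G : sgraph) t : ncliques t [set: G] = num_cliques t G.
Proof. by apply: eq_card => A; rewrite !inE subsetT. Qed.

(** The cliques that avoid [J] are bounded by Zykov's theorem, and those through
a vertex of [J] by the same theorem in its neighbourhood. *)
Lemma num_cliques_le (G : sgraph) r t (J : {set G}) a :
  clique_free r.+3 G -> {in J, forall x, degree x <= a} ->
  num_cliques t.+1 G <=
  turan_cliques r.+2 (#|G| - #|J|) t.+1 + #|J| * turan_cliques r.+1 a t.
Proof.
move=> freeG degJ.
have free : ncliques r.+3 [set: G] = 0.
  apply/eqP; rewrite cards_eq0; apply/eqP/setP=> A; rewrite !inE.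
  by apply/negbTE/negP => /and3P[_ /freeG/eqP/negbTE->].
have sub_free (S : {set G}) s : ncliques s [set: G] = 0 -> ncliques s S = 0.
  by move=> E; apply/eqP; rewrite -leqn0 -E ncliques_sub ?subsetT.
rewrite -ncliques_setT -(setUCr J) setUC.
apply: leq_trans (ncliquesU_le (c := turan_cliques r.+1 a t) _) _ => [u uJ|].
  have -> : (~: J :|: J) :&: nbhd u = nbhd u by rewrite setUC setUCr setTI.
  apply: leq_trans (ncliques_le_turan _ _) _; last exact/turan_cliques_mono/degJ.
  by apply/eqP; have := ncliques_nbhd r.+2 (in_setT u); rewrite free leqn0 setTI.
rewrite leq_add2r.
have -> : #|G| - #|J| = #|~: J| by rewrite -(cardsC J) addKn.
exact/ncliques_le_turan/sub_free.
Qed.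

Lemma iso_num_cliques (G H : sgraph) t :
  iso G H -> num_cliques t G = num_cliques t H.
Proof.
case=> f [[g fK gK] fadj].
rewrite /num_cliques -(card_imset _ (imset_inj (can_inj fK))).
apply: eq_card => B; rewrite inE; apply/imsetP/andP=> [[A + ->]|[clB cardB]].
  rewrite inE => /andP[/is_cliqueP clA cardA].
  rewrite card_imset ?cardA; last exact: can_inj fK.
  split=> //; apply/is_cliqueP=> _ _ /imsetP[x xA ->] /imsetP[y yA ->] neq.
  by rewrite fadj clA //; apply: contraNneq neq => ->.
exists (g @: B); last first.
  by rewrite -imset_comp (eq_imset _ gK) imset_id.
rewrite inE card_imset ?cardB ?andbT; last exact: can_inj gK.
apply/is_cliqueP=> _ _ /imsetP[x xB ->] /imsetP[y yB ->] neq.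
by rewrite -fadj !gK (is_cliqueP _ clB) //; apply: contraNneq neq => ->.
Qed.

Lemma order_bound_admissible L r n : 2 < r ->
  (order_bound (L%:Z - 1) r <= n%:R)%R -> admissible r L n.
Proof.
have lE : ((L%:Z - 1)%:~R = L%:R - 1 :> rat)%R by rewrite rmorphB.
rewrite /order_bound lE => r_gt2.
have [->|r3] := eqVneq r 3.
  rewrite /admissible /= => H; apply/orP; left.
  by rewrite -(ler_nat rat) natrD natrM; lra.
have [r_le7|r_gt7] := leqP r 7.
  rewrite ge_max => /andP[].
  have : [|| r == 4, r == 5, r == 6 | r == 7] by lia.
  rewrite /admissible.
  case/or4P=> /eqP->.
  - rewrite (_ : (4%:R - 3 = 1 :> rat)%R) //.
    rewrite (_ : (2 * 4%:R - 2 = 6 :> rat)%R) // => H1 H2.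
    by rewrite /=; apply/orP; left; rewrite -(ler_nat rat) natrD natrM; lra.
  - rewrite (_ : (5%:R - 3 = 2 :> rat)%R) //.
    rewrite (_ : (2 * 5%:R - 2 = 8 :> rat)%R) // => H1 H2.
    by rewrite /=; apply/orP; left; apply/andP; split;
      rewrite -(ler_nat rat) natrD ?natrM; lra.
  - rewrite (_ : (6%:R - 3 = 3 :> rat)%R) //.
    rewrite (_ : (2 * 6%:R - 2 = 10 :> rat)%R) // => H1 H2.
    by rewrite /=; apply/orP; left; apply/andP; split;
      rewrite -(ler_nat rat) natrD ?natrM; lra.
  rewrite (_ : (7%:R - 3 = 4 :> rat)%R) //.
  rewrite (_ : (2 * 7%:R - 2 = 12 :> rat)%R) // => H1 H2.
  by rewrite /=; apply/orP; left; apply/andP; split;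
      rewrite -(ler_nat rat) natrD ?natrM; lra.
have [k ->] : exists k, r = k + 8 by exists (r - 8); lia.
have -> : ((k + 8)%:R - 4 = (k + 4)%:R :> rat)%R by rewrite !natrD; lra.
have k_gt0 : (0 < (k + 4)%:R :> rat)%R by rewrite ltr0n addn_gt0 orbT.
rewrite -lerBrDl ler_pdivrMr // => H.
have {}H : 4 * (L + 3) + (L + 4) * (k + 4) <= n * (k + 4).
  by rewrite -(ler_nat rat) natrD !natrM !natrD; move: H; rewrite natrD; lra.
rewrite /admissible; apply/or4P; apply: Or44; do 2 (apply/orP; right).
have : L + 4 <= n by rewrite -(@leq_pmul2r (k + 4)); lia.
nia.
Qed.

(** There are [n - n %/ r] vertices outside the residue class of the last one of
[n + 1] vertices, and it has to be joined to [L] of them. *)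
Lemma admissible_size L r n : 2 < r -> admissible r L n.+1 -> L + n %/ r <= n.
Proof.
move=> r_gt2 cond.
have := leq_divM n r; set d := n %/ r => le_d.
suff : L * r <= n * r.-1.
  rewrite -(@leq_pmul2r r) ?mulnDl; last by lia.
  by case: r r_gt2 {cond} d le_d => // r _ d; nia.
move: cond {d le_d}; rewrite /admissible.
case/or4P; last case/or3P.
all: repeat (case/andP).
- by move=> /eqP->; lia.
- by move=> /eqP->; lia.
- by move=> /eqP->; lia.
- by move=> /eqP->; lia.
- by move=> /eqP->; lia.
move=> r_gt3; have [k ->] : exists k, r = k + 3 by exists (r - 3); lia.
have -> : k + 3 - 3 = k by lia.
have -> : (k + 3).-1 = k + 2 by lia.
nia.
Qed.

Local Open Scope ring_scope.

Theorem corollary7p10 (l : int) (r n : nat)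
    (hl : -1 <= l) (hr : (3 <= r)%N)
    (hn : order_bound l r <= n%:R \/ [/\ l = 1, r = 8%N & n = 10%N])
    (G : sgraph) (hG : #|G| = n) (hfree : clique_free r.+1 G)
    (hdeg : exists j : nat,
        [/\ (1 <= j)%N,
            j%:R <= (n%:R - 1 - l%:~R) / 2 :> rat
          & (sorted_degree G j)%:Z <= j%:Z + l]) :
  (forall t : nat, (2 <= t)%N ->
      (num_cliques t G <= num_cliques t (colex_turan l r n))%N)
  /\ (iso G (colex_turan l r n) ->
      forall t : nat, (2 <= t)%N ->
        num_cliques t G = num_cliques t (colex_turan l r n)).
Proof.
split=> [|isoG t _]; last exact: iso_num_cliques.
have [L El] : exists L : nat, l = L%:Z - 1 by exists (absz (l + 1)); lia.
have cond : admissible r L n.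
  case: hn => [|[l1 -> ->]]; first by rewrite El; apply: order_bound_admissible.
  by have -> : L = 2%N by lia.
rewrite {}El in hdeg *.
case: hdeg => j [j_gt0 le_j deg_j].
have {}le_j : (2 * j + L <= n)%N.
  by rewrite -(ler_nat rat) natrD natrM; move: le_j; rewrite rmorphB /=; lra.
case: j j_gt0 => // p _ in le_j deg_j *.
have {}deg_j : (sorted_degree G p.+1 <= p + L)%N by lia.
case: n hG cond le_j {hn} => [|n] hG cond le_j; first by lia.
have [q le_qp le_q] := admissible_degree_sum cond le_j.
have le_L := admissible_size hr cond.
case: r hr hfree cond le_q le_L => [|[|[|r]]] // _ hfree cond le_q le_L.
case=> [|[|t]] // _.
have j_in : (0 < p.+1 <= #|G|)%N by lia.
have le_qj : (q.+1 <= p.+1)%N by [].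
have [J cardJ degJ] := low_degree_set j_in le_qj deg_j.
apply: leq_trans (num_cliques_le t.+1 hfree degJ) _.
apply: leq_trans (colex_turan_num_cliques_ge t.+1 _ le_L) => //.
rewrite cardJ hG subSS (@turan_cliques_drop _ n q); last by lia.
rewrite -addnA leq_add2l [X in (_ <= X)%N]addnC.
apply: (tangent_jensen (K := fun x => turan_cliques r.+2 x t.+1)
  (b := fun k => turan_degree r.+3 (n - k.+1)%N)).
  exact: turan_cliques_tangent.
have -> : (q.+1 * (p + L) = L + (q * (p + L) + p))%N by lia.
by rewrite leq_add2l; exact: le_q.
Qed.
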